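(* Let $U_1$ be the resonant tongue, emanating from $(\delta,\gamma)=(0,1)$, of the Hill equation $$\ddot{\xi}(t)+\big(\gamma+y(t)^2\big)\xi(t)=0,$$ where $y=y_\delta$ is the solution of $\ddot y+y+y^3=0$, $y(0)=\delta$, $\dot y(0)=0$. Then $$U_1=\Big\{(\delta,\gamma)\in\mathbb{R}^2_+ :\ 1<\gamma<1+\frac{\delta^2}{2}\Big\}.$$
   Context: $\mathbb{R}^2_+=\{(\delta,\gamma):\delta>0,\gamma>0\}$. For $\delta>0$ the solution $y$ of $\ddot y+y+y^3=0$, $y(0)=\delta$, $\dot y(0)=0$, is periodic with some minimal period $T(\delta)>0$, and $y^2$ has minimal period $\tau=T(\delta)/2$; moreover $T(\delta)\to 2\pi$ as $\delta\downarrow0$. The trivial solution of the Hill equation $\ddot\xi+(\gamma+y^2)\xi=0$ is called stable if all its solutions are bounded on $\mathbb{R}$, and unstable otherwise. The monodromy matrix $M(\delta,\gamma)$ is the value at $t=\tau$ of the fundamental matrix (of the associated first order system) which is the identity at $t=0$. For an integer $\ell\ge1$, the resonant tongue $U_\ell$ emanating from $(\delta,\gamma)=(0,\ell^2)$ is the $\ell$-th (open) instability region in the parameter plane: the set of $(\delta,\gamma)$ with $\delta>0$, $\gamma>0$ such that $|\operatorname{tr}M(\delta,\gamma)|>2$ and such that the nontrivial real solutions satisfying $\xi(t+\tau)=\mu\,\xi(t)$ for all $t$ (with $\mu$ a real eigenvalue of $M(\delta,\gamma)$) have exactly $\ell$ zeros in $[0,\tau)$. *)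

(* Defs.v *)
From HB Require Import structures.
From mathcomp Require Import all_boot all_order all_algebra.
From mathcomp Require Import all_classical all_reals all_analysis.

Set Implicit Arguments.
Unset Strict Implicit.
Unset Printing Implicit Defensive.

Import Order.TTheory GRing.Theory Num.Theory.
Import numFieldNormedType.Exports.

Local Open Scope ring_scope.
Local Open Scope classical_set_scope.

Definition twice_derivable (R : realType) (x : R -> R) : Prop :=
  forall t : R, derivable x t 1 /\ derivable x^`() t 1.

Definition duffing_solution (R : realType) (delta : R) (y : R -> R) : Prop :=
  [/\ twice_derivable y,
      forall t : R, (y^`()^`())%classic t + y t + y t ^+ 3 = 0,
      y 0 = delta
    & y^`() 0 = 0].

Definition minimal_period (R : realType) (f : R -> R) (T : R) : Prop :=
  [/\ 0 < T,
      forall t : R, f (t + T) = f t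
    & forall S : R, 0 < S -> (forall t : R, f (t + S) = f t) -> T <= S].

Definition hill_solution (R : realType) (gamma : R) (y xi : R -> R) : Prop :=
  twice_derivable xi /\
  forall t : R, (xi^`()^`())%classic t + (gamma + y t ^+ 2) * xi t = 0.

(* Coefficient matrix [[0, 1], [-(gamma + y^2), 0]] of the first order system
   satisfied by the column (xi, xi'). *)
Definition hill_matrix (R : realType) (gamma : R) (y : R -> R) (t : R) :
    'M[R]_2 :=
  \matrix_(i, j) if i == 0 then (j == 1)%:R
                 else - (gamma + y t ^+ 2) * (j == 0)%:R.

Definition fundamental_matrix (R : realType) (gamma : R) (y : R -> R)
    (Phi : R -> 'M[R]_2) : Prop :=
  Phi 0 = 1%:M /\
  forall t : R, is_derive t 1 Phi (hill_matrix gamma y t *m Phi t).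

(* Common period of the coefficients gamma + y_delta^2: as y_delta has minimal
   period T delta, y_delta^2 has minimal period T delta / 2. *)
Definition tau (R : realType) (T : R -> R) (delta : R) : R := T delta / 2.

Definition monodromy (R : realType) (T : R -> R) (Phi : R -> R -> R -> 'M[R]_2)
    (delta gamma : R) : 'M[R]_2 :=
  Phi delta gamma (tau T delta).

(* The l-th open instability region (l >= 1) in the open quadrant of
   parameters p = (delta, gamma); y delta, T delta and Phi delta gamma are meant
   to be the Duffing solution, its minimal period and the fundamental matrix.
   When the trace exceeds 2 in absolute value the monodromy matrix has two real
   eigenvalues, and the zero count is required for each of them.  [eigenvalue]
   is about row eigenvectors, which for a square matrix gives the same
   eigenvalues as column eigenvectors. *)
Definition tongue (R : realType) (y : R -> R -> R) (T : R -> R)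
    (Phi : R -> R -> R -> 'M[R]_2) (l : nat) : set (R * R) :=
  [set p | let: (delta, gamma) := p in
    [/\ 0 < delta, 0 < gamma,
        2 < `|\tr (monodromy T Phi delta gamma)|
      & forall (mu : R) (xi : R -> R),
          eigenvalue (monodromy T Phi delta gamma) mu ->
          hill_solution gamma (y delta) xi ->
          (exists t, xi t != 0) ->
          (forall t : R, xi (t + tau T delta) = mu * xi t) ->
          ([set t | 0 <= t < tau T delta /\ xi t = 0] #= `I_l)%card]].

(* Main.v *)
(* The Hill equation is a Lame equation with one finite gap, and everything is read off the
   function [w = y^2 - 2 (gamma - 1)], which satisfies the equation of products of two solutions.
   It provides a quadratic form in [(x, x')] that is constant along every solution [x] and has
   periodic coefficients, hence is invariant under the monodromy matrix [M].  At [t = 0] the form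
   is diagonal.  It is semidefinite exactly when [gamma] is outside the interval, and then
   [|tr M| <= 2].

   Inside the interval the form is indefinite, so [|tr M| >= 2], with equality only if
   [M = 1] or [M = -1].  Equality is excluded by Sturm comparison with [y], which solves the
   equation for [gamma = 1].  A Floquet solution is a null vector of the form, so its zeros are
   among the two zeros that [w] has in a period, and it vanishes at exactly one of these. *)

Require Import Defs.
From HB Require Import structures.
From mathcomp Require Import all_boot all_order all_algebra.
From mathcomp Require Import all_classical all_reals all_analysis.
From mathcomp Require Import ring lra.

Set Implicit Arguments.
Unset Strict Implicit.
Unset Printing Implicit Defensive.

Import Order.TTheory GRing.Theory Num.Theory.
Import numFieldNormedType.Exports.

Local Open Scope ring_scope.
Local Open Scope classical_set_scope.

(** * One-variable calculus: derivatives as a relation, mean values, zeros *)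

Section Derivatives.
Context {R : realType}.
Implicit Types f g : R -> R.

(** A relation rather than an operator: the rules below build a derivative by unification, and
    [deriv] leaves only an identity between two expressions of it. *)
Definition has_deriv f f' := forall t, is_derive t (1 : R) f (f' t).

Lemma has_deriv_eq f f1 f' : has_deriv f f1 -> f1 =1 f' -> has_deriv f f'.
Proof. by move=> Df e t; apply: is_derive_eq (Df t) (e t). Qed.

Lemma has_deriv_cst a : has_deriv (fun _ => a) (fun _ => 0).
Proof. by move=> t; apply: is_derive_cst. Qed.

Lemma has_deriv_id : has_deriv (fun t => t) (fun _ => 1).
Proof. by move=> t; apply: is_derive_id. Qed.

Lemma has_derivD f g f' g' : has_deriv f f' -> has_deriv g g' ->
  has_deriv (fun t => f t + g t) (fun t => f' t + g' t).
Proof. by move=> Df Dg t; apply: (is_deriveD (Df t) (Dg t)). Qed.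

Lemma has_derivN f f' : has_deriv f f' -> has_deriv (fun t => - f t) (fun t => - f' t).
Proof. by move=> Df t; apply: (is_deriveN (Df t)). Qed.

Lemma has_derivM f g f' g' : has_deriv f f' -> has_deriv g g' ->
  has_deriv (fun t => f t * g t) (fun t => f t * g' t + g t * f' t).
Proof. by move=> Df Dg t; apply: (is_deriveM (Df t) (Dg t)). Qed.

Lemma has_derivX f f' n : has_deriv f f' ->
  has_deriv (fun t => f t ^+ n) (fun t => n%:R * f t ^+ n.-1 * f' t).
Proof.
move=> Df t; have := is_deriveX n (Df t).
by rewrite (_ : f ^+ n = fun t => f t ^+ n)//; apply/funext => u; rewrite exprfctE.
Qed.

Lemma has_deriv_comp f f' g g' : has_deriv f f' -> has_deriv g g' ->
  has_deriv (fun t => f (g t)) (fun t => f' (g t) * g' t).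
Proof. by move=> Df Dg t; apply: (is_derive1_comp (Df (g t)) (Dg t)). Qed.

Lemma has_deriv_expR : has_deriv expR expR.
Proof. by move=> t; apply: is_derive_expR. Qed.

Lemma has_deriv_continuous f f' : has_deriv f f' -> continuous f.
Proof.
by move=> Df t; apply/differentiable_continuous/derivable1_diffP/(@ex_derive _ _ _ _ _ _ _ (Df t)).
Qed.

Lemma has_deriv_unique f f' f'' : has_deriv f f' -> has_deriv f f'' -> f' =1 f''.
Proof.
by move=> D1 D2 t; rewrite -(@derive_val _ _ _ _ _ _ _ (D1 t)) (@derive_val _ _ _ _ _ _ _ (D2 t)).
Qed.

Lemma has_deriv0_cst f s t : has_deriv f (fun _ => 0) -> f s = f t.
Proof. by move=> Df; apply: is_derive_0_is_cst => x; apply: Df. Qed.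

Lemma segment_MVT f f' (a b : R) : a < b ->
  (forall t, a <= t <= b -> is_derive t (1 : R) f (f' t)) ->
  exists2 c, a < c < b & f b - f a = f' c * (b - a).
Proof.
move=> ab Df; have [x|x|c cab ->] := @MVT R f f' a b ab.
- by rewrite in_itv /= => /andP[ax xb]; apply: Df; rewrite !ltW.
- apply: derivable_within_continuous => t; rewrite in_itv /= => tab.
  exact: (@ex_derive _ _ _ _ _ _ _ (Df t tab)).
- by exists c => //; move: cab; rewrite in_itv.
Qed.

Lemma has_deriv_MVT f f' a b : has_deriv f f' -> a < b ->
  exists2 c, a < c < b & f b - f a = f' c * (b - a).
Proof. by move=> Df ab; apply: segment_MVT ab _ => t _; apply: Df. Qed.

Lemma has_deriv_Rolle f f' a b : has_deriv f f' -> a < b -> f a = f b ->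
  exists2 c, a < c < b & f' c = 0.
Proof.
move=> Df ab fab; have [c cab e] := has_deriv_MVT Df ab; exists c => //.
by move/eqP: e; rewrite fab subrr eq_sym mulf_eq0 subr_eq0 (gt_eqF ab) orbF => /eqP.
Qed.

Lemma continuous_IVT0 f a b : continuous f -> a <= b -> f a * f b <= 0 ->
  exists2 c, a <= c <= b & f c = 0.
Proof.
move=> fc ab fab; have [||c cab fc0] := @IVT R f a b 0 ab.
- exact: continuous_subspaceT.
- rewrite ge_min le_max; apply/andP; split; apply/orP.
  + have [fa|fa] := leP (f a) 0; [by left|right; rewrite leNgt; apply/negP; nra].
  + have [fa|fa] := leP 0 (f a); [by left|right; rewrite leNgt; apply/negP; nra].
- by exists c => //; move: cab; rewrite in_itv.
Qed.

Lemma continuous_neq0_nbhs f p : continuous f -> f p != 0 ->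
  exists2 e, 0 < e & forall t, `|t - p| < e -> f t != 0.
Proof.
move=> fc fp.
have [e /= e0 He] := cvgr_neq0 (f p) (fc p) fp.
exists e => // t tp; apply: He.
by rewrite /ball /= distrC.
Qed.

Lemma continuous_eq0_closure f p q : continuous f -> p < q ->
  (forall t, p < t < q -> f t = 0) -> f p = 0 /\ f q = 0.
Proof.
move=> fc pq f0.
have small e : 0 < e -> exists u, [/\ 0 < u, u < e & u < q - p].
  move=> e0; exists (Num.min e (q - p) / 2).
  have m0 : 0 < Num.min e (q - p) by rewrite lt_min e0 subr_gt0.
  have me : Num.min e (q - p) <= e by rewrite ge_min lexx.
  have mq : Num.min e (q - p) <= q - p by rewrite ge_min lexx orbT.
  by split; lra.
split; apply/eqP/negP => /negP /(continuous_neq0_nbhs fc)[e /small[u [u0 ue uq]] He].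
- have := He (p + u); rewrite addrAC subrr add0r gtr0_norm// => /(_ ue).
  by rewrite f0 ?eqxx//; apply/andP; split; lra.
- have := He (q - u); rewrite addrAC subrr add0r normrN gtr0_norm// => /(_ ue).
  by rewrite f0 ?eqxx//; apply/andP; split; lra.
Qed.

Lemma has_deriv_eq0 f f' p q : has_deriv f f' -> (forall t, p < t < q -> f t = 0) ->
  forall t, p < t < q -> f' t = 0.
Proof.
move=> Df f0 t /andP[pt tq].
have : is_derive t (1 : R) (fun _ => 0) (f' t).
  apply: near_eq_is_derive (Df t); near=> u; apply: f0.
  by apply/andP; split; near: u; [apply: lt_nbhsr|apply: lt_nbhsl].
move=> D; rewrite -(@derive_val _ _ _ _ _ _ _ D).
exact: (@derive_val _ _ _ _ _ _ _ (has_deriv_cst 0 t)).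
Unshelve. all: by end_near. Qed.

End Derivatives.

Ltac deriv_rules := repeat first
  [ eassumption | apply: has_deriv_cst | apply: has_deriv_id | apply: has_derivD
  | apply: has_derivN | apply: has_derivM | apply: has_derivX | apply: has_deriv_expR ].

Ltac deriv := eapply has_deriv_eq; [deriv_rules | move=> ? /=].

(** * The Duffing equation *)

Section Duffing.
Context {R : realType}.
Implicit Types x dx y dy z dz : R -> R.

Definition duffing_flow y dy :=
  has_deriv y dy /\ has_deriv dy (fun t => - (y t + y t ^+ 3)).

Lemma duffing_flow_of_solution delta y :
  duffing_solution delta y -> duffing_flow y y^`().
Proof.
move=> [dd eqn _ _]; split=> t; have [d1 d2] := dd t; rewrite ?derive1E.
  exact: derivableP.
have := derivableP d2; rewrite -derive1E => /is_derive_eq; apply.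
by have := eqn t; lra.
Qed.

Lemma duffing_flow_rev a y dy : duffing_flow y dy ->
  duffing_flow (fun t => y (a - t)) (fun t => - dy (a - t)).
Proof.
move=> [Dy Ddy]; have Da : has_deriv (fun t : R => a - t) (fun _ => -1).
  by deriv; ring.
by split; [have := has_deriv_comp Dy Da|have := has_derivN (has_deriv_comp Ddy Da)];
  move/has_deriv_eq; apply=> t /=; ring.
Qed.

Lemma duffing_flow_shift a y dy : duffing_flow y dy ->
  duffing_flow (fun t => y (a + t)) (fun t => dy (a + t)).
Proof.
move=> [Dy Ddy]; have Da : has_deriv (fun t : R => a + t) (fun _ => 1).
  by deriv; ring.
by split; [have := has_deriv_comp Dy Da|have := has_deriv_comp Ddy Da];
  move/has_deriv_eq; apply=> t /=; ring.
Qed.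

Lemma duffing_flowN y dy : duffing_flow y dy ->
  duffing_flow (fun t => - y t) (fun t => - dy t).
Proof. by move=> [Dy Ddy]; split; deriv; ring. Qed.

Lemma duffing_energy y dy t : duffing_flow y dy ->
  dy t ^+ 2 + y t ^+ 2 + y t ^+ 4 / 2 = dy 0 ^+ 2 + y 0 ^+ 2 + y 0 ^+ 4 / 2.
Proof.
move=> [Dy Ddy].
by apply: (@has_deriv0_cst _ (fun t => dy t ^+ 2 + y t ^+ 2 + y t ^+ 4 / 2)); deriv; field.
Qed.

(** Gronwall's argument: the squared distance [N] of the two phase points satisfies N' <= K N, so N
    exp(-K s) cannot increase from its initial value 0. *)
Lemma duffing_unique x dx z dz t : duffing_flow x dx -> duffing_flow z dz ->
  x 0 = z 0 -> dx 0 = dz 0 -> 0 <= t -> x t = z t.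
Proof.
move=> fx fz xz0 dxz0; rewrite le_eqVlt => /predU1P[<-//|t0].
(* The common energy K/3 bounds x^2 and z^2, so the factor [P] in x^3 - z^3 = P (x - z) lies between
   0 and K. *)
pose K := 3 * (dx 0 ^+ 2 + x 0 ^+ 2 + x 0 ^+ 4 / 2).
pose N s := (x s - z s) ^+ 2 + (dx s - dz s) ^+ 2.
pose P s := x s ^+ 2 + x s * z s + z s ^+ 2.
have PK s : 0 <= P s <= K.
  have xE := duffing_energy s fx; have zE := duffing_energy s fz.
  rewrite -xz0 -dxz0 in zE.
  have := sqr_ge0 (dx s); have := sqr_ge0 (dz s).
  have := sqr_ge0 (x s ^+ 2); have := sqr_ge0 (z s ^+ 2); rewrite -!exprM.
  rewrite /P /K; have := sqr_ge0 (x s - z s); have := sqr_ge0 (x s + z s).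
  by move=> *; apply/andP; split; lra.
have DF : has_deriv (fun s => N s * expR (- (K * s)))
    (fun s => (- 2 * P s * ((x s - z s) * (dx s - dz s)) - K * N s) * expR (- (K * s))).
  case: fx fz => [Dx Ddx] [Dz Ddz].
  have DK : has_deriv (fun s => expR (- (K * s))) (fun s => - K * expR (- (K * s))).
    have Dk : has_deriv (fun s => - (K * s)) (fun _ => - K) by deriv; ring.
    by apply: has_deriv_eq (has_deriv_comp has_deriv_expR Dk) _ => s /=; ring.
  by rewrite /N; deriv; rewrite /N /P; ring.
have [c _] := has_deriv_MVT DF t0.
have -> : N 0 = 0 by rewrite /N xz0 dxz0 !subrr expr0n /= addr0.
rewrite mul0r !subr0 => e.
have : N t * expR (- (K * t)) <= 0.
  rewrite e; apply: mulr_le0_ge0; last exact: ltW.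
  apply: mulr_le0_ge0; last exact: expR_ge0.
  have /andP[P0 PleK] := PK c.
  have N0 : 0 <= N c by rewrite addr_ge0 ?sqr_ge0.
  have : 0 <= P c * ((x c - z c) + (dx c - dz c)) ^+ 2 by rewrite mulr_ge0 ?sqr_ge0.
  have : 0 <= (K - P c) * N c by rewrite mulr_ge0 ?subr_ge0.
  by rewrite /N; lra.
rewrite pmulr_lle0 ?expR_gt0// /N => N0.
have : (x t - z t) ^+ 2 <= 0 by have := sqr_ge0 (dx t - dz t); lra.
by rewrite le_eqVlt ltNge sqr_ge0 orbF sqrf_eq0 subr_eq0 => /eqP.
Qed.

(** Time reversal preserves the equation and, as [dy 0 = 0], the initial data. *)
Lemma duffing_even y dy t : duffing_flow y dy -> dy 0 = 0 -> y (- t) = y t.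
Proof.
move=> fy dy0; have fr := duffing_flow_rev 0 fy.
have even s : 0 <= s -> y (- s) = y s.
  move=> s0; rewrite -[- s]add0r.
  by apply: (duffing_unique fr fy) => //; rewrite subr0// dy0 oppr0.
have [t0|t0] := leP 0 t; first exact: even.
by rewrite -[in RHS](opprK t) [RHS]even// oppr_ge0 ltW.
Qed.

(** Both sides solve the equation in [t], with the same data at t = 0 because [y q = 0]. *)
Lemma duffing_odd q y dy t : duffing_flow y dy -> y q = 0 -> y (q + t) = - y (q - t).
Proof.
move=> fy yq; have fl := duffing_flow_shift q fy.
have fr := duffing_flowN (duffing_flow_rev q fy).
have odd s : 0 <= s -> y (q + s) = - y (q - s).
  by apply: (duffing_unique fl fr); rewrite ?addr0 ?subr0 ?yq ?oppr0 ?opprK.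
have [t0|t0] := leP 0 t; first exact: odd.
by have := odd (- t); rewrite oppr_ge0 opprK => /(_ (ltW t0)) ->; rewrite opprK.
Qed.

Lemma continuous_first_zero (f : R -> R) p : continuous f -> 0 < f 0 -> 0 <= p -> f p = 0 ->
  exists q, [/\ 0 < q, f q = 0 & forall t : R, 0 <= t < q -> 0 < f t].
Proof.
move=> fc f0 p0 fp; pose S := [set t | 0 <= t /\ f t = 0].
have lbS : lbound S 0 by move=> t [].
have infS : has_inf S by split; [exists p|exists 0].
have fq : f (inf S) = 0.
  apply/eqP/negP => /negP /(continuous_neq0_nbhs fc)[e e0 He].
  have [s Ss se] := inf_adherent e0 infS.
  have qs := ge_inf infS.2 Ss.
  by have := He s; rewrite Ss.2 eqxx ger0_norm ?subr_ge0// ltrBlDl => /(_ se).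
have q0 : 0 <= inf S by apply: lb_le_inf; [exists p|].
exists (inf S); split => //.
- by rewrite lt_neqAle q0 andbT; apply/eqP => q00; move: fq f0; rewrite -q00 => ->; rewrite ltxx.
- move=> t /andP[t0 tq]; rewrite ltNge; apply/negP => ft.
  have [c /andP[c0 ct] fc0] := continuous_IVT0 fc t0 (mulr_ge0_le0 (ltW f0) ft).
  by have := ge_inf infS.2 (conj c0 fc0 : S c); rewrite leNgt (le_lt_trans ct tq).
Qed.

(** The quarter period [q] is the first zero of [y]. Evenness about 0 and oddness about [q] give y(t
    + 2q) = -y(t), so 4q is a period; it remains to exclude a shorter one. *)
Lemma duffing_quarter_period y dy T : duffing_flow y dy -> 0 < y 0 -> dy 0 = 0 ->
  minimal_period y T ->
  exists q, [/\ 0 < q, T / 2 = q + q, y q = 0, forall t : R, 0 <= t < q -> 0 < y t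
    & forall s t : R, 0 <= s -> s < t -> t <= q -> y t < y s].
Proof.
move=> fy y0 dy0 [T0 yT minT]; have [Dy Ddy] := fy.
(* y' agrees at 0 and [T], so Rolle's theorem gives a zero of y'' = -y (1 + y^2). *)
have [p pT yp] : exists2 p, 0 < p < T & y p = 0.
  have [|p pT dyp] := @has_deriv_Rolle _ _ _ 0 T Ddy T0.
    have := has_deriv_unique (duffing_flow_shift T fy).1.
    have DyT : has_deriv (fun t => y (T + t)) dy.
      by move=> t; rewrite (_ : (fun t => _) = y)//; apply/funext => u; rewrite addrC yT.
    by move=> /(_ _ DyT 0); rewrite addr0.
  exists p => //; have : y p * (1 + y p ^+ 2) = 0 by rewrite -[RHS]oppr0 -dyp; ring.
  move/eqP; rewrite mulf_eq0 [_ + _ == 0]gt_eqF ?orbF => [/eqP//|].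
  by have := sqr_ge0 (y p); lra.
have [q [q0 yq ypos]] := continuous_first_zero (has_deriv_continuous Dy) y0 (ltW (andP pT).1) yp.
have dyneg t : 0 < t -> t <= q -> dy t < 0.
  move=> t0 tq; have [c /andP[c0 ct]] := has_deriv_MVT Ddy t0.
  have yc : 0 < y c by apply: ypos; apply/andP; split; lra.
  by rewrite dy0 !subr0 => ->; rewrite pmulr_llt0// oppr_lt0 addr_gt0 ?exprn_gt0.
have decr s t : 0 <= s -> s < t -> t <= q -> y t < y s.
  move=> s0 st tq; have [c /andP[sc ct] e] := has_deriv_MVT Dy st.
  by rewrite -subr_lt0 e pmulr_llt0 ?subr_gt0// dyneg; lra.
exists q; split => //.
have half t : y (t + (q + q)) = - y t.
  rewrite (_ : t + _ = q + (q + t)); last ring.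
  by rewrite (duffing_odd _ fy yq) (_ : q - _ = - t) ?(duffing_even _ fy)//; ring.
have Tle : T <= 4 * q.
  apply: minT => [|t]; first lra.
  by rewrite (_ : t + _ = t + (q + q) + (q + q)) ?half ?opprK//; ring.
have lt_half t : 0 < t -> t <= q + q -> y t < y 0.
  move=> t0 t2; have [tq|qt] := leP t q; first exact: decr.
  rewrite (_ : t = q + (t - q)); last ring.
  rewrite (duffing_odd _ fy yq) (_ : q - _ = q + q - t); last ring.
  by have := ypos (q + q - t); rewrite subr_ge0 t2 ltrBlDr ltrD2l qt => /(_ isT); lra.
(* A period T < 4q would bring [y] back to [y 0] too early: y < y(0) on (0, 2q], and y(T) = y(4q -
   T) reduces the case T > 2q to that interval. *)
suff : 4 * q <= T by lra.
rewrite leNgt; apply/negP => Tlt.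
have := yT 0; rewrite add0r; have [T2|T2] := leP T (q + q).
  by move=> e; have := lt_half _ T0 T2; rewrite e ltxx.
have -> : y T = y (4 * q - T).
  by rewrite -(duffing_even T fy dy0) -[LHS]opprK -2!half; congr y; ring.
move=> e; have := lt_half (4 * q - T); rewrite e ltxx => H.
by have : false by apply: H; lra.
Qed.

End Duffing.

(** * Hill equations *)

Section Hill.
Context {R : realType}.
Implicit Types Q x dx c dc s ds : R -> R.

Definition hill_flow Q x dx := has_deriv x dx /\ has_deriv dx (fun t => - (Q t * x t)).

Definition hill_potential gamma y : R -> R := fun t => gamma + y t ^+ 2.

Lemma hill_flow_of_solution gamma y x :
  hill_solution gamma y x -> hill_flow (hill_potential gamma y) x x^`().
Proof.
move=> [dd eqn]; split=> t; have [d1 d2] := dd t; rewrite ?derive1E.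
  exact: derivableP.
have := derivableP d2; rewrite -derive1E => /is_derive_eq; apply.
by have := eqn t; rewrite /hill_potential; lra.
Qed.

Lemma hill_flow_fundamental gamma y (Phi : R -> 'M[R]_2) (j : 'I_2) :
  fundamental_matrix gamma y Phi ->
  hill_flow (hill_potential gamma y) (fun t => Phi t 0 j) (fun t => Phi t 1 j).
Proof.
move=> [_ DPhi].
have DPhiij i t : is_derive t (1 : R) (fun u => Phi u i j)
    ((hill_matrix gamma y t *m Phi t) i j).
  have [dM eM] := DPhi t; apply: DeriveDef; first exact: (derivable_mxP Phi t 1).1.
  by rewrite -eM derive_mx// mxE.
split=> t; apply: is_derive_eq (DPhiij _ t) _; rewrite mxE !big_ord_recl big_ord0 !mxE /=.
  by rewrite mul0r add0r addr0 mul1r; congr (Phi t _ j); apply: val_inj.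
by rewrite mulr1 mulr0 mul0r !addr0 mulNr; congr (- (_ * Phi t _ j)); apply: val_inj.
Qed.

Lemma hill_wronskian Q x dx z dz u t : hill_flow Q x dx -> hill_flow Q z dz ->
  x u * dz u - dx u * z u = x t * dz t - dx t * z t.
Proof.
move=> [Dx Ddx] [Dz Ddz].
by apply: (@has_deriv0_cst _ (fun t => x t * dz t - dx t * z t)); deriv; ring.
Qed.

Lemma hill_flow_comb Q x dx z dz a b : hill_flow Q x dx -> hill_flow Q z dz ->
  hill_flow Q (fun t => a * x t + b * z t) (fun t => a * dx t + b * dz t).
Proof. by move=> [Dx Ddx] [Dz Ddz]; split; deriv; ring. Qed.

Lemma hill_flow_shift Q x dx a : (forall t, Q (t + a) = Q t) -> hill_flow Q x dx ->
  hill_flow Q (fun t => x (t + a)) (fun t => dx (t + a)).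
Proof.
move=> Qa [Dx Ddx]; have Da : has_deriv (fun t : R => t + a) (fun _ => 1).
  by deriv; ring.
by split; [have := has_deriv_comp Dx Da|have := has_deriv_comp Ddx Da];
  move/has_deriv_eq; apply=> t /=; rewrite ?Qa mulr1.
Qed.

(** If [z] had no zero, x / z would vanish at both ends while its derivative, minus the constant
    Wronskian over z^2, never vanishes. *)
Lemma sturm_separation Q x dx z dz a b : a < b -> hill_flow Q x dx -> hill_flow Q z dz ->
  x a * dz a - dx a * z a != 0 -> x a = 0 -> x b = 0 ->
  exists2 r, a <= r <= b & z r = 0.
Proof.
move=> ab fx fz W xa xb; apply/not_exists2P => z0.
have zne t : a <= t <= b -> z t != 0.
  by move=> tab; apply/eqP => zt; case: (z0 t) => [/(_ tab)|/(_ zt)].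
have [Dx _] := fx; have [Dz _] := fz.
have [t tab|r /andP[ar rb]] := @segment_MVT _ (fun t => x t * (z t)^-1)
    (fun t => (dx t * z t - x t * dz t) / z t ^+ 2) a b ab.
  have zt := zne t tab.
  apply: is_derive_eq (is_deriveM (Dx t) (is_deriveV zt (Dz t))) _.
  by rewrite /GRing.scale /=; field.
rewrite xa xb !mul0r subrr => /esym/eqP; rewrite mulf_eq0 subr_eq0 (gt_eqF ab) orbF.
have zr : z r != 0 by rewrite zne// !ltW.
rewrite mulf_eq0 invr_eq0 sqrf_eq0 (negPf zr) orbF.
by rewrite -oppr_eq0 opprB -(hill_wronskian a r fx fz) (negPf W).
Qed.

(** The columns (c, dc) and (s, ds) of a fundamental matrix that is the identity at 0. *)
Definition normalized_pair Q c dc s ds := [/\ hill_flow Q c dc, hill_flow Q s ds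
  & [/\ c 0 = 1, dc 0 = 0, s 0 = 0 & ds 0 = 1]].

Lemma normalized_pair_fundamental gamma y (Phi : R -> 'M[R]_2) :
  fundamental_matrix gamma y Phi ->
  normalized_pair (hill_potential gamma y) (fun t => Phi t 0 0) (fun t => Phi t 1 0)
    (fun t => Phi t 0 1) (fun t => Phi t 1 1).
Proof.
by move=> F; split; try exact: hill_flow_fundamental F; rewrite F.1 !mxE.
Qed.

Section NormalizedPair.
Variables (Q c dc s ds : R -> R).
Hypothesis cs : normalized_pair Q c dc s ds.

Lemma normalized_wronskian t : c t * ds t - dc t * s t = 1.
Proof.
have [fc fs [c0 dc0 s0 ds0]] := cs.
by rewrite (hill_wronskian t 0 fc fs) c0 dc0 s0 ds0; ring.
Qed.

(** Cramer's rule: the Wronskians of [x] with [c] and [s] keep their values at 0, and that of [c]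
    with [s] is 1. *)
Lemma normalized_repr x dx t : hill_flow Q x dx ->
  x t = x 0 * c t + dx 0 * s t /\ dx t = x 0 * dc t + dx 0 * ds t.
Proof.
move=> fx; have [fc fs [c0 dc0 s0 ds0]] := cs.
have := hill_wronskian t 0 fx fc; have := hill_wronskian t 0 fx fs.
rewrite c0 dc0 s0 ds0 !mulr0 !mulr1 sub0r subr0 => es ec.
have W := normalized_wronskian t.
split.
  rewrite -[LHS]mulr1 -W.
  by transitivity ((x t * ds t - dx t * s t) * c t - (x t * dc t - dx t * c t) * s t);
    [ring|rewrite es ec; ring].
rewrite -[LHS]mulr1 -W.
by transitivity ((x t * ds t - dx t * s t) * dc t - (x t * dc t - dx t * c t) * ds t);
  [ring|rewrite es ec; ring].
Qed.

Lemma hill_flow_eq0 x dx p : hill_flow Q x dx -> x p = 0 -> dx p = 0 -> forall t, x t = 0.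
Proof.
move=> fx xp dxp t; have [fc fs [c0 dc0 s0 ds0]] := cs.
have := hill_wronskian p t fx fc; have := hill_wronskian p t fx fs.
rewrite xp dxp !mul0r subr0 => es ec.
rewrite -[LHS]mulr1 -(normalized_wronskian t).
transitivity ((x t * ds t - dx t * s t) * c t - (x t * dc t - dx t * c t) * s t); first ring.
by rewrite -es -ec; ring.
Qed.

Lemma hill_flow_vanishing_at p : exists x dx, [/\ hill_flow Q x dx, x p = 0 & dx p = 1].
Proof.
have [fc fs _] := cs; have W := normalized_wronskian p.
exists (fun t => - s p * c t + c p * s t), (fun t => - s p * dc t + c p * ds t).
by split; [exact: hill_flow_comb|ring|rewrite -[RHS]W; ring].
Qed.

End NormalizedPair.
End Hill.

(** * The invariant quadratic form *)

(** A change of sign would force a zero of f g in between, where f^2 = g^2 and g <> 0 are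
    incompatible. *)
Lemma sqr_eq_same_sign {R : realType} (f g : R -> R) p r : continuous f -> continuous g ->
  (forall t : R, p < t < r -> f t ^+ 2 = g t ^+ 2 /\ g t != 0) ->
  (forall t : R, p < t < r -> f t = g t) \/ (forall t : R, p < t < r -> f t = - g t).
Proof.
move=> fc gc fg.
have no_mix a b : p < a < r -> p < b < r -> f a = g a -> f b = - g b -> False.
  move=> /andP[pa ar] /andP[pb br] fa fb.
  have hc : continuous (fun t => f t * g t) by move=> t; apply: cvgM; [exact: fc|exact: gc].
  have sgn : f a * g a * (f b * g b) <= 0.
    by rewrite fa fb; have := sqr_ge0 (g a * g b); lra.
  have [c /andP[pc cr] /eqP] : exists2 c, p < c < r & f c * g c = 0.
    have [ab|/ltW ba] := leP a b.
      have [c /andP[ac cb] hc0] := continuous_IVT0 hc ab sgn.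
      by exists c => //; apply/andP; split; lra.
    rewrite mulrC in sgn; have [c /andP[ac cb] hc0] := continuous_IVT0 hc ba sgn.
    by exists c => //; apply/andP; split; lra.
  have [fgc gc0] : f c ^+ 2 = g c ^+ 2 /\ g c != 0 by apply: fg; rewrite pc.
  rewrite mulf_eq0 (negPf gc0) orbF => /eqP fc0; move: fgc.
  by rewrite fc0 expr0n /= => /esym/eqP; rewrite sqrf_eq0 (negPf gc0).
have dich t : p < t < r -> f t = g t \/ f t = - g t.
  by move=> /fg[/eqP + _]; rewrite eqf_sqr => /orP[]/eqP; [left|right].
have [[a [pa fa]]|none] := pselect (exists a, p < a < r /\ f a = g a).
  by left=> t pt; have [//|ft] := dich t pt; case: (no_mix a t).
by right=> t pt; have [ft|//] := dich t pt; case: none; exists t.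
Qed.

Section Lame.
Context {R : realType}.
Variables (y dy : R -> R) (gamma : R).

(* [lame_product] (= [w]) is the product of two Floquet solutions: it solves the third order
   equation [w''' + 4 Q w' + 2 Q' w = 0].  If [w = u v], then [lame_form x] is the product of the
   Wronskians of [x] with [u] and with [v]. *)
Definition lame_product t := y t ^+ 2 - 2 * (gamma - 1).
Definition lame_dproduct t := 2 * y t * dy t.
Definition lame_half_ddproduct t := dy t ^+ 2 - y t ^+ 2 - y t ^+ 4.

Local Notation Q := (hill_potential gamma y).
Local Notation w := lame_product.
Local Notation dw := lame_dproduct.
Local Notation hddw := lame_half_ddproduct.

Definition lame_form (x dx : R -> R) t :=
  w t * dx t ^+ 2 - dw t * x t * dx t + (hddw t + Q t * w t) * x t ^+ 2.

Hypothesis fy : duffing_flow y dy.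
Hypothesis dy0 : dy 0 = 0.

Lemma lame_product_deriv : has_deriv w dw.
Proof. by have [Dy _] := fy; rewrite /lame_product /lame_dproduct; deriv; ring. Qed.

Lemma lame_dproduct_deriv : has_deriv dw (fun t => 2 * hddw t).
Proof. by have [Dy Ddy] := fy; rewrite /lame_dproduct /lame_half_ddproduct; deriv; ring. Qed.

Let Dw := lame_product_deriv.
Let Ddw := lame_dproduct_deriv.

Lemma lame_form_cst x dx t u : hill_flow Q x dx -> lame_form x dx t = lame_form x dx u.
Proof.
move=> [Dx Ddx]; apply: has_deriv0_cst; have [Dy Ddy] := fy.
rewrite /lame_form /hill_potential /lame_half_ddproduct; rewrite /hill_potential in Ddx.
by deriv; rewrite /lame_dproduct /lame_product /lame_half_ddproduct; ring.
Qed.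

Lemma lame_energy t : dy t ^+ 2 = y 0 ^+ 2 + y 0 ^+ 4 / 2 - y t ^+ 2 - y t ^+ 4 / 2.
Proof. by have := duffing_energy t fy; rewrite dy0 expr0n /=; lra. Qed.

(** Where y^2 has its initial value, the energy forces y' = 0, so the cross term of the form
    disappears. *)
Lemma lame_form_extremum x dx t : y t ^+ 2 = y 0 ^+ 2 -> lame_form x dx t =
  (y 0 ^+ 2 - 2 * (gamma - 1)) * dx t ^+ 2
  - (gamma - 1) * (2 * gamma + y 0 ^+ 2) * x t ^+ 2.
Proof.
move=> yt; have /eqP : dy t ^+ 2 = 0 by rewrite lame_energy (exprM (y t) 2 2) yt; ring.
rewrite sqrf_eq0 => /eqP dyt.
rewrite /lame_form /lame_product /lame_dproduct /lame_half_ddproduct /hill_potential.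
by rewrite dyt (exprM (y t) 2 2) yt; ring.
Qed.

(** Completing the square in x' leaves the coefficient w'^2 - 2 w w'' - 4 Q w^2, which the energy
    makes constant. For w = u v it is the squared Wronskian of [u] and [v]. *)
Lemma lame_discriminant x dx t : (2 * w t * dx t - dw t * x t) ^+ 2 =
  4 * w t * lame_form x dx t
  + 4 * (gamma - 1) * (y 0 ^+ 2 - 2 * (gamma - 1)) * (y 0 ^+ 2 + 2 * gamma) * x t ^+ 2.
Proof.
have -> : (2 * w t * dx t - dw t * x t) ^+ 2 =
    4 * w t ^+ 2 * dx t ^+ 2 - 4 * w t * dw t * dx t * x t + 4 * y t ^+ 2 * dy t ^+ 2 * x t ^+ 2.
  by rewrite /lame_dproduct; ring.
rewrite /lame_form /lame_half_ddproduct lame_energy.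
by rewrite /lame_dproduct /lame_product /hill_potential; field.
Qed.

Lemma lame_dproduct_sqr t : w t = 0 -> dw t ^+ 2 =
  4 * (gamma - 1) * (y 0 ^+ 2 - 2 * (gamma - 1)) * (y 0 ^+ 2 + 2 * gamma).
Proof.
(* In the discriminant identity [x] and [dx] are independent functions; the values 1 and 0 isolate
   w'^2. *)
move=> wt; have := lame_discriminant (fun=> 1) (fun=> 0) t.
by rewrite wt /= => e; rewrite -[RHS]mulr1 -[X in _ * X](expr1n _ 2); lra.
Qed.

Section NullSolution.
Variables (x dx : R -> R).
Hypothesis fx : hill_flow Q x dx.
Hypothesis x_nontrivial : forall t, x t = 0 -> dx t <> 0.
Hypothesis x_null : lame_form x dx 0 = 0.

(** At a zero of [x] the form reduces to w x'^2, and x' is nonzero there. *)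
Lemma null_zero t : x t = 0 -> w t = 0.
Proof.
move=> xt; have := lame_form_cst t 0 fx; rewrite x_null /lame_form xt => e.
apply/eqP; have /eqP : w t * dx t ^+ 2 = 0 by rewrite -[RHS]e; ring.
by rewrite mulf_eq0 sqrf_eq0 => /orP[//|/eqP]; move/(x_nontrivial xt).
Qed.

(** The function f = 2 w x' - w' x - h x vanishes inside the interval, hence so does f'. Both extend
    by continuity to the endpoint, where the terms in [w] drop out. *)
Lemma null_endpoint (h p r e : R) : p < r -> e = p \/ e = r -> w e = 0 ->
  (forall t : R, p < t < r -> 2 * w t * dx t - dw t * x t = h * x t) ->
  (dw e + h) * x e = 0 /\ (dw e - h) * dx e = 2 * hddw e * x e.
Proof.
move=> pr epr we H; have [Dx Ddx] := fx.
pose f t := 2 * w t * dx t - dw t * x t - h * x t.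
pose df t := - 2 * w t * (Q t * x t) + (dw t - h) * dx t - 2 * hddw t * x t.
have Df : has_deriv f df.
  have [Dy Ddy] := fy; rewrite /f /df; deriv.
  by rewrite /lame_dproduct /lame_product /lame_half_ddproduct /hill_potential; ring.
(* A derivative of [df] provides its continuity at the endpoints. *)
have [ddf Ddf] : exists ddf, has_deriv df ddf.
  have [Dy Ddy] := fy; eexists; rewrite /df /lame_half_ddproduct /hill_potential; deriv_rules.
have f0 (t : R) : p < t < r -> f t = 0 by move=> pt; rewrite /f H// subrr.
have fe : f e = 0.
  by have [] := continuous_eq0_closure (has_deriv_continuous Df) pr f0; case: epr => ->.
have dfe : df e = 0.
  have df0 := has_deriv_eq0 Df f0.
  by have [] := continuous_eq0_closure (has_deriv_continuous Ddf) pr df0; case: epr => ->.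
by move: fe dfe; rewrite /f /df we => fe dfe; split; lra.
Qed.

(* The factor [2 w x' - w' x = h x] satisfied by a null solution keeps the same sign of [h] across
   the interval, whereas [w'] takes opposite values at the two ends. *)
Lemma null_vanishes_once p r : p < r -> w p = 0 -> w r = 0 ->
  (forall t : R, p < t < r -> w t != 0) -> dw r = - dw p -> dw p != 0 ->
  x p = 0 /\ x r <> 0 \/ x p <> 0 /\ x r = 0.
Proof.
move=> pr wp wr wne dwr dwp; have [Dx Ddx] := fx.
have k2 := lame_dproduct_sqr wp.
(* The form vanishes, so the discriminant identity turns into an equality of squares with constant
   w'(p)^2. *)
have phi2 t : (2 * w t * dx t - dw t * x t) ^+ 2 = (dw p * x t) ^+ 2.
  by rewrite lame_discriminant (lame_form_cst t 0 fx) x_null mulr0 add0r -k2 [RHS]exprMn.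
have phic : continuous (fun t => 2 * w t * dx t - dw t * x t).
  by apply: has_deriv_continuous; deriv_rules.
have kxc : continuous (fun t => dw p * x t).
  by apply: has_deriv_continuous; deriv_rules.
have same (t : R) : p < t < r ->
    (2 * w t * dx t - dw t * x t) ^+ 2 = (dw p * x t) ^+ 2 /\ dw p * x t != 0.
  move=> pt; split; first exact: phi2.
  by rewrite mulf_neq0//; apply/eqP => /null_zero; apply/eqP/wne.
have [H|H] := sqr_eq_same_sign phic kxc same.
(* Here h = w'(p). At [p] the factor w' + h is 2 w'(p), so x(p) = 0. At [r] the factor w' - h is -2
   w'(p), so x(r) = 0 would imply x'(r) = 0. *)
- have [xp _] := null_endpoint pr (or_introl erefl) wp H.
  have [_ dxr] := null_endpoint pr (or_intror erefl) wr H.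
  left; split.
    apply/eqP; have /eqP := xp; rewrite -mulr2n -mulr_natl -mulrA mulf_eq0 mulf_eq0.
    by rewrite pnatr_eq0 (negPf dwp).
  move=> xr; apply: (x_nontrivial xr); apply/eqP.
  have /eqP : dw p * dx r = 0 by move: dxr; rewrite dwr xr; lra.
  by rewrite mulf_eq0 (negPf dwp).
- have {}H (t : R) : p < t < r -> 2 * w t * dx t - dw t * x t = - dw p * x t.
    by move=> pt; rewrite H// mulNr.
  have [_ dxp] := null_endpoint pr (or_introl erefl) wp H.
  have [xr _] := null_endpoint pr (or_intror erefl) wr H.
  right; split.
    move=> xp; apply: (x_nontrivial xp); apply/eqP.
    have /eqP : dw p * dx p = 0 by move: dxp; rewrite xp; lra.
    by rewrite mulf_eq0 (negPf dwp).
  apply/eqP; have /eqP : dw p * x r = 0 by move: xr; rewrite dwr; lra.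
  by rewrite mulf_eq0 (negPf dwp).
Qed.

End NullSolution.
End Lame.

(** * Zeros of null solutions *)

Section LameZeros.
Context {R : realType}.
Variables (y dy : R -> R) (gamma q : R).
Hypothesis fy : duffing_flow y dy.
Hypothesis dy0 : dy 0 = 0.
Hypothesis q0 : 0 < q.
Hypothesis yq : y q = 0.
Hypothesis y_gt0 : forall t : R, 0 <= t < q -> 0 < y t.
Hypothesis y_decr : forall s t : R, 0 <= s -> s < t -> t <= q -> y t < y s.

Local Notation Q := (hill_potential gamma y).
Local Notation w := (lame_product y gamma).
Local Notation dw := (lame_dproduct y dy).

Lemma duffing_half_period t : y (t + (q + q)) = - y t.
Proof.
rewrite (_ : t + _ = q + (q + t)); last ring.
by rewrite (duffing_odd _ fy yq) (_ : q - _ = - t) ?(duffing_even _ fy)//; ring.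
Qed.

Lemma hill_potential_period t : Q (t + (q + q)) = Q t.
Proof. by rewrite /hill_potential duffing_half_period sqrrN. Qed.

Lemma lame_product_even t : w (0 - t) = w t.
Proof. by rewrite sub0r /lame_product (duffing_even _ fy). Qed.

Lemma lame_product_reflect t : w (q + q - t) = w t.
Proof. by rewrite /lame_product [q + q - t]addrC duffing_half_period sqrrN (duffing_even _ fy). Qed.

Lemma lame_dproduct_reflect a t : (forall u, w (a - u) = w u) -> dw (a - t) = - dw t.
Proof.
move=> wa; have Dw := lame_product_deriv gamma fy.
have Da : has_deriv (fun u : R => a - u) (fun _ => -1) by deriv; ring.
have := has_deriv_comp Dw Da.
rewrite (_ : (fun u => w (a - u)) = w); last exact/funext.
by move=> /(has_deriv_unique Dw)/(_ t) ->; ring.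
Qed.

Hypothesis gamma_gap : 1 < gamma < 1 + y 0 ^+ 2 / 2.

(** In the gap w(0) > 0 > w(q). The root is unique because [y] is nonnegative and strictly
    decreasing on [0, q], so y^2 takes each value at most once. *)
Lemma lame_product_root : exists p, [/\ 0 < p < q, w p = 0
  & forall t : R, 0 <= t <= q -> w t = 0 -> t = p].
Proof.
have /andP[g1 g2] := gamma_gap.
have w0 : 0 < w 0 by rewrite /lame_product; lra.
have wq : w q < 0 by rewrite /lame_product yq; lra.
have wc := has_deriv_continuous (lame_product_deriv gamma fy).
have [p /andP[p0 pq] wp] := continuous_IVT0 wc (ltW q0) (mulr_ge0_le0 (ltW w0) (ltW wq)).
have p_gt0 : 0 < p.
  by rewrite lt_neqAle p0 andbT; apply/eqP => e; move: wp w0; rewrite -e => ->; rewrite ltxx.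
have p_ltq : p < q.
  by rewrite lt_neqAle pq andbT; apply/eqP => e; move: wq; rewrite -e wp ltxx.
exists p; split => //; first exact/andP.
have y_ge0 t : 0 <= t <= q -> 0 <= y t.
  move=> /andP[t0]; rewrite le_eqVlt => /predU1P[->|tq]; first by rewrite yq.
  by rewrite ltW// y_gt0// t0.
move=> t tq wt; have : y t ^+ 2 = y p ^+ 2 by move: wt wp; rewrite /lame_product; lra.
move/eqP; rewrite eqrXn2// ?y_ge0// ?p0// => /eqP ytp.
have /andP[t0 tleq] := tq.
case: (ltgtP t p) => // [tp|pt]; first by have := y_decr t0 tp pq; rewrite ytp ltxx.
by have := y_decr p0 pt tleq; rewrite ytp ltxx.
Qed.

Section Root.
Variable p : R.
Hypothesis p0q : 0 < p < q.
Hypothesis wp : w p = 0.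
Hypothesis p_unique : forall t : R, 0 <= t <= q -> w t = 0 -> t = p.

Lemma lame_product_roots_even (t : R) : - q <= t <= q -> w t = 0 -> t = - p \/ t = p.
Proof.
move=> /andP[qt tq] wt; have [t0|t0] := leP 0 t.
  by right; apply: p_unique => //; rewrite t0.
left; rewrite -[LHS]opprK; congr (- _); apply: p_unique.
  by apply/andP; split; lra.
by rewrite -sub0r lame_product_even.
Qed.

Lemma lame_product_roots_period (t : R) : 0 <= t <= q + q -> w t = 0 -> t = p \/ t = q + q - p.
Proof.
move=> /andP[t0 t2] wt; have [tq|qt] := leP t q.
  by left; apply: p_unique => //; rewrite t0.
right; have <- : q + q - t = p; last ring.
by apply: p_unique; [apply/andP; split; lra|rewrite lame_product_reflect].
Qed.

(** The discriminant is positive in the gap, so the roots of [w] are simple. *)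
Lemma lame_dproduct_root_neq0 : dw p != 0.
Proof.
have /andP[g1 g2] := gamma_gap.
rewrite -sqrf_eq0 (lame_dproduct_sqr fy dy0 wp) gt_eqF//.
by rewrite !mulr_gt0//; have := sqr_ge0 (y 0); lra.
Qed.

Variables (x dx : R -> R).
Hypothesis fx : hill_flow Q x dx.
Hypothesis x_nontrivial : forall t, x t = 0 -> dx t <> 0.
Hypothesis x_null : lame_form y dy gamma x dx 0 = 0.

(** By evenness -p and p are consecutive roots of [w] with opposite slopes. *)
Lemma null_vanishes_once_even : x p = 0 -> x (- p) <> 0.
Proof.
have /andP[p0 pq] := p0q; have wNp : w (- p) = 0 by rewrite -sub0r lame_product_even.
have dwp : dw p = - dw (- p).
  by rewrite -[- p]sub0r (lame_dproduct_reflect _ lame_product_even) opprK.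
have wne (t : R) : - p < t < p -> w t != 0.
  move=> /andP[tp pt]; apply/eqP => /lame_product_roots_even[|e|e].
  - by apply/andP; split; lra.
  - by rewrite e ltxx in tp.
  - by rewrite e ltxx in pt.
have dwNp : dw (- p) != 0 by rewrite -oppr_eq0 -dwp lame_dproduct_root_neq0.
have Npp : - p < p by lra.
by case: (null_vanishes_once fy dy0 fx x_nontrivial x_null Npp wNp wp wne dwp dwNp) => -[].
Qed.

(** Reflection in [q] gives [w] opposite slopes at its consecutive roots [p] and [q + q - p], the
    only candidates for zeros of [x] in a period. *)
Lemma null_card_zeros : ([set t | 0 <= t < q + q /\ x t = 0] #= `I_1)%card.
Proof.
have /andP[p0 pq] := p0q; have wr : w (q + q - p) = 0 by rewrite lame_product_reflect.
have dwr := lame_dproduct_reflect p lame_product_reflect.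
have pr : p < q + q - p by lra.
have wne (t : R) : p < t < q + q - p -> w t != 0.
  move=> /andP[pt tr]; apply/eqP => /lame_product_roots_period[|e|e].
  - by apply/andP; split; lra.
  - by rewrite e ltxx in pt.
  - by rewrite e ltxx in tr.
have zeros (t : R) : 0 <= t < q + q -> x t = 0 -> t = p \/ t = q + q - p.
  move=> /andP[t0 t2] xt; apply: lame_product_roots_period; first by rewrite t0 ltW.
  exact: (null_zero fy fx x_nontrivial x_null xt).
suff [u ->] : exists u, [set t | 0 <= t < q + q /\ x t = 0] = [set u] by exact: card_set1.
case: (null_vanishes_once fy dy0 fx x_nontrivial x_null pr wp wr wne dwr
  lame_dproduct_root_neq0) => -[xp xr]; [exists p|exists (q + q - p)]; apply/seteqP; split=> t /=.
- by case=> tq xt; have [//|e] := zeros t tq xt; case: xr; rewrite -e.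
- by move=> ->; split=> //; apply/andP; split; lra.
- by case=> tq xt; have [e|//] := zeros t tq xt; case: xp; rewrite -e.
- by move=> ->; split=> //; apply/andP; split; lra.
Qed.

End Root.

(* If all solutions vanishing at [- q] vanished at [q], such a solution [z] would have no zero
   inside [(-q, q)]: there it would be separated by the zeros of the null solution vanishing at
   [p].  This contradicts the comparison with [y], which is the solution for [gamma = 1]. *)
Lemma lame_no_coexistence c dc s ds : normalized_pair Q c dc s ds ->
  ~ (forall x dx, hill_flow Q x dx -> x (- q) = 0 -> x q = 0).
Proof.
move=> cs coex; have /andP[g1 g2] := gamma_gap.
have [p [p0q wp p_unique]] := lame_product_root; have /andP[p0 pq] := p0q.
have [z [dz [fz zNq dzNq]]] := hill_flow_vanishing_at cs (- q).
have zq := coex _ _ fz zNq.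
have [u [du [fu up dup]]] := hill_flow_vanishing_at cs p.
have u_nontrivial t : u t = 0 -> du t <> 0.
  move=> ut dut; have u0 := hill_flow_eq0 cs fu ut dut.
  have Du0 : has_deriv u (fun=> 0).
    by rewrite (_ : u = fun=> 0); [exact: has_deriv_cst|exact/funext].
  by have /eqP := has_deriv_unique fu.1 Du0 p; rewrite dup oner_eq0.
have u_null : lame_form y dy gamma u du 0 = 0.
  by rewrite (lame_form_cst fy 0 p fu) /lame_form wp up; ring.
have u_zero (t : R) : - q < t < q -> u t = 0 -> t = p.
  move=> /andP[qt tq] ut; have wt := null_zero fy fu u_nontrivial u_null ut.
  case: (lame_product_roots_even p_unique _ wt) => [|tNp|//]; first by rewrite !ltW.
  by case: (null_vanishes_once_even p0q wp p_unique fu u_nontrivial u_null up); rewrite -tNp.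
(* At -q the form equals w(-q) = -2 (gamma - 1) < 0. Being constant, it forces w < 0 at every zero
   of [z]; in particular z(p) <> 0. *)
have z_form : lame_form y dy gamma z dz 0 < 0.
  rewrite (lame_form_cst fy 0 (- q) fz) /lame_form zNq dzNq /lame_product.
  by rewrite (duffing_even _ fy dy0) yq; lra.
have zero_w t : z t = 0 -> w t < 0.
  move=> zt; move: z_form; rewrite (lame_form_cst fy 0 t fz) /lame_form zt.
  have := sqr_ge0 (dz t); nra.
have zp : z p != 0 by apply/eqP => /zero_w; rewrite wp ltxx.
have u_ne t : t = - q \/ t = q -> u t <> 0.
  move=> tq /(null_zero fy fu u_nontrivial u_null).
  rewrite /lame_product; have -> : y t = 0.
    by case: tq => ->; rewrite ?(duffing_even _ fy dy0).
  lra.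
have wr t : z t = 0 -> z t * du t - dz t * u t != 0.
  move=> zt; rewrite (hill_wronskian t p fz fu) up dup mulr0 subr0 mulr1.
  exact: zp.
(* A zero [t] of [z] inside would give [u] a zero on each side of it. Both must be [p], the only
   zero of [u] in (-q, q), so t = p, contradicting z(p) <> 0. *)
have z_ne (t : R) : - q < t < q -> z t != 0.
  move=> /andP[qt tq]; apply/eqP => zt.
  have [a /andP[qa at_] ua] := sturm_separation qt fz fu (wr _ zNq) zNq zt.
  have [b /andP[tb bq] ub] := sturm_separation tq fz fu (wr _ zt) zt zq.
  have ap : a = p.
    apply: u_zero => //; rewrite (le_lt_trans at_ tq) andbT lt_neqAle qa andbT.
    by apply/eqP => e; apply: (u_ne a) => //; left.
  have bp : b = p.
    apply: u_zero => //; rewrite (lt_le_trans qt tb) /= lt_neqAle bq andbT.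
    by apply/eqP => e; apply: (u_ne b) => //; right.
  by move/eqP: zp; apply; rewrite (_ : p = t)//; apply/eqP; rewrite eq_le -{1}bp -ap; lra.
have [Dy Ddy] := fy; have [Dz Ddz] := fz.
(* The Wronskian of [y] and [z] vanishes at both ends; by Rolle's theorem its derivative (1 - gamma)
   z y vanishes inside, where neither factor does. *)
have DW : has_deriv (fun t => dz t * y t - z t * dy t)
    (fun t => (1 - gamma) * (z t * y t)).
  by deriv; rewrite /hill_potential; ring.
have yNq : y (- q) = 0 by rewrite (duffing_even _ fy dy0).
have [||t tq] := has_deriv_Rolle (a := - q) (b := q) DW; first lra.
  by rewrite zNq zq yNq yq; ring.
apply/eqP; rewrite !mulf_neq0 ?z_ne//; first by apply/eqP; lra.
have [t0|t0] := leP 0 t; first by rewrite gt_eqF// y_gt0// t0; case/andP: tq.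
rewrite -(duffing_even _ fy dy0) gt_eqF// y_gt0//; apply/andP; split; first lra.
by case/andP: tq; lra.
Qed.

End LameZeros.

(** * The monodromy matrix *)

Section Trace.
Context {R : realType}.

(** For M = [[a, b], [c, d]] of determinant 1 and G = diag(B, A), invariance reads G M = M^(-T) G;
    this compares the upper left entries. *)
Lemma form_isometry_diag (A B a b c d : R) : B != 0 -> a * d - c * b = 1 ->
  B * a ^+ 2 + A * c ^+ 2 = B -> B * a * b + A * c * d = 0 -> a = d.
Proof.
move=> B0 det e1 e3; apply: (mulfI B0).
have -> : B * a = B * a * (a * d - c * b) by rewrite det mulr1.
transitivity ((B * a ^+ 2 + A * c ^+ 2) * d - c * (B * a * b + A * c * d)); first ring.
by rewrite e1 e3; ring.
Qed.

(** If B <> 0, then a = d and B^2 a^2 = B^2 - A B c^2 <= B^2, so a^2 <= 1. If B = 0, the matrix is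
    triangular with equal diagonal entries 1 or -1. *)
Lemma form_isometry_trace_le2 (A B a b c d : R) : 0 <= A * B -> A != 0 \/ B != 0 ->
  a * d - c * b = 1 -> B * a ^+ 2 + A * c ^+ 2 = B -> B * b ^+ 2 + A * d ^+ 2 = A ->
  B * a * b + A * c * d = 0 -> `|a + d| <= 2.
Proof.
move=> AB AB0 det e1 e2 e3.
have [ad a2] : a = d /\ a ^+ 2 <= 1.
  have [B0|B0] := eqVneq B 0.
    have A0 : A != 0 by case: AB0 => //; rewrite B0 eqxx.
    have c0 : c = 0.
      apply/eqP; have /eqP : A * c ^+ 2 = 0 by rewrite -[RHS]B0 -[in RHS]e1 B0; ring.
      by rewrite mulf_eq0 (negPf A0) sqrf_eq0.
    have d2 : d ^+ 2 = 1.
      by apply: (mulfI A0); rewrite mulr1 -[RHS]e2 B0; ring.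
    have ad : a = d by rewrite -[a]mulr1 -d2 expr2 mulrA -[RHS]mul1r -det c0; ring.
    by rewrite ad d2.
  split; first exact: form_isometry_diag B0 det e1 e3.
  have : 0 < B ^+ 2 by rewrite exprn_even_gt0.
  have : B ^+ 2 * a ^+ 2 = B ^+ 2 - A * B * c ^+ 2.
    by rewrite expr2 -{3}e1; ring.
  have := mulr_ge0 AB (sqr_ge0 c).
  by nra.
by rewrite ler_norml -ad; apply/andP; split; nra.
Qed.

(** Multiplying v (M - mu) = 0 by the adjugate of M - mu shows that the characteristic polynomial at
    [mu] annihilates [v]. *)
Lemma eigenvalue_mx2 (M : 'M[R]_2) mu : eigenvalue M mu ->
  mu ^+ 2 - (M 0 0 + M 1 1) * mu + (M 0 0 * M 1 1 - M 1 0 * M 0 1) = 0.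
Proof.
move=> /eigenvalueP[v vM v0].
have E j : v 0 0 * M 0 j + v 0 1 * M 1 j = mu * v 0 j.
  have /matrixP/(_ 0 j) := vM; rewrite !mxE !big_ord_recl big_ord0 addr0 => <-.
  by congr (_ + v 0 _ * M _ j); apply: val_inj.
have E0 := E 0; have E1 := E 1.
set chi := LHS.
have chi0 : chi * v 0 0 = 0.
  transitivity ((v 0 0 * M 0 0 + v 0 1 * M 1 0 - mu * v 0 0) * (M 1 1 - mu)
    - (v 0 0 * M 0 1 + v 0 1 * M 1 1 - mu * v 0 1) * M 1 0); first by rewrite /chi; ring.
  by rewrite E0 E1; ring.
have chi1 : chi * v 0 1 = 0.
  transitivity ((v 0 0 * M 0 1 + v 0 1 * M 1 1 - mu * v 0 1) * (M 0 0 - mu)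
    - (v 0 0 * M 0 0 + v 0 1 * M 1 0 - mu * v 0 0) * M 0 1); first by rewrite /chi; ring.
  by rewrite E0 E1; ring.
apply/eqP; apply: contraNT v0 => chin0; apply/eqP/rowP => j; rewrite mxE.
move/eqP: chi0; move/eqP: chi1; rewrite !mulf_eq0 (negPf chin0) /= => /eqP v1 /eqP v00.
by case: j => [[|[|//]] jlt]; [rewrite -[RHS]v00|rewrite -[RHS]v1]; congr (v 0 _); apply: val_inj.
Qed.

Lemma mxtrace2 (M : 'M[R]_2) : \tr M = M 0 0 + M 1 1.
Proof.
by rewrite /mxtrace !big_ord_recl big_ord0 addr0; congr (_ + M _ _); apply: val_inj.
Qed.

End Trace.

(** * Trace of the monodromy matrix and zeros of Floquet solutions *)

Section Monodromy.
Context {R : realType}.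
Variables (y dy : R -> R) (gamma q : R).
Hypothesis fy : duffing_flow y dy.
Hypothesis dy0 : dy 0 = 0.
Hypothesis y0_gt0 : 0 < y 0.
Hypothesis yq : y q = 0.
Variables (c dc s ds : R -> R).
Hypothesis cs : normalized_pair (hill_potential gamma y) c dc s ds.

Local Notation Q := (hill_potential gamma y).
Local Notation tq := (q + q).
Local Notation A := (y 0 ^+ 2 - 2 * (gamma - 1)).
Local Notation B := (- ((gamma - 1) * (2 * gamma + y 0 ^+ 2))).

Lemma lame_form_period x dx : hill_flow Q x dx ->
  B * x tq ^+ 2 + A * dx tq ^+ 2 = B * x 0 ^+ 2 + A * dx 0 ^+ 2.
Proof.
move=> fx; have := lame_form_cst fy tq 0 fx.
rewrite !(lame_form_extremum _ fy dy0)//; first lra.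
by rewrite -[tq]add0r (duffing_half_period fy dy0 yq) sqrrN.
Qed.

Lemma monodromy_isometry :
  [/\ c tq * ds tq - dc tq * s tq = 1, B * c tq ^+ 2 + A * dc tq ^+ 2 = B,
      B * s tq ^+ 2 + A * ds tq ^+ 2 = A & B * c tq * s tq + A * dc tq * ds tq = 0].
Proof.
have [fc fs [c0 dc0 s0 ds0]] := cs.
have ec := lame_form_period fc; have es := lame_form_period fs.
(* Polarization: the solution c + s yields the mixed identity. *)
have ecs := lame_form_period (hill_flow_comb 1 1 fc fs).
rewrite c0 dc0 s0 ds0 in ec es ecs.
split; first exact: (normalized_wronskian cs).
- by rewrite ec; ring.
- by rewrite es; ring.
- by move: ecs; nra.
Qed.

(** For gamma <= 1 one has A > 0 and B >= 0; for gamma >= 1 + y(0)^2 / 2, A <= 0 and B < 0. So the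
    form is semidefinite and nonzero. *)
Lemma stable_trace : 0 < gamma -> ~ (1 < gamma < 1 + y 0 ^+ 2 / 2) ->
  `|c tq + ds tq| <= 2.
Proof.
move=> g0 gap; have [det e1 e2 e3] := monodromy_isometry.
have d2 : 0 < y 0 ^+ 2 by rewrite exprn_gt0.
apply: form_isometry_trace_le2 det e1 e2 e3.
  have [g1|g1] := leP gamma 1; first by apply: mulr_ge0; nra.
  have g2 : 1 + y 0 ^+ 2 / 2 <= gamma by rewrite leNgt; apply/negP => g2; apply: gap; rewrite g1.
  by apply: mulr_le0; nra.
have [->|g1] := eqVneq gamma 1; first by left; rewrite subrr mulr0 subr0 gt_eqF.
right; rewrite oppr_eq0 mulf_neq0 ?subr_eq0// gt_eqF//; lra.
Qed.

Hypothesis q0 : 0 < q.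
Hypothesis y_gt0 : forall t : R, 0 <= t < q -> 0 < y t.
Hypothesis y_decr : forall s t : R, 0 <= s -> s < t -> t <= q -> y t < y s.
Hypothesis gamma_gap : 1 < gamma < 1 + y 0 ^+ 2 / 2.

Lemma unstable_trace : 2 < `|c tq + ds tq|.
Proof.
rewrite ltNge; apply/negP => tr2; have /andP[g1 g2] := gamma_gap.
have [det e1 e2 e3] := monodromy_isometry.
have A0 : 0 < A by lra.
have B0 : B < 0 by have := sqr_ge0 (y 0); nra.
have ad := form_isometry_diag (negbT (lt_eqF B0)) det e1 e3.
have a2 : c tq ^+ 2 <= 1 by move: tr2; rewrite -ad ler_norml => /andP[]; nra.
have sq_eq0 (k u : R) : k != 0 -> k * u ^+ 2 = 0 -> u = 0.
  by move=> k0 /eqP; rewrite mulf_eq0 (negPf k0) sqrf_eq0 => /eqP.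
(* The isometry relation B (a^2 - 1) + A c'^2 = 0, where a = c(2q) and c' = dc(2q), has two
   nonnegative terms, so both vanish. *)
have Ac : 0 <= A * dc tq ^+ 2 by rewrite mulr_ge0 ?sqr_ge0// ltW.
have Ba : 0 <= B * (c tq ^+ 2 - 1) by apply: mulr_le0; [exact: ltW|lra].
have dcq : dc tq = 0.
  by apply: (sq_eq0 A); [rewrite gt_eqF|lra].
have a1 : c tq ^+ 2 = 1.
  by apply: (mulfI (negbT (lt_eqF B0))); rewrite -[RHS]mulr1 in e1 *; move: e1; rewrite dcq; lra.
have sq : s tq = 0.
  apply: (sq_eq0 B); first by rewrite lt_eqF.
  by move: e2; rewrite -ad a1; lra.
(* The monodromy matrix is now the scalar [c tq], so x(q) = c(2q) x(-q) for every solution. *)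
apply: (lame_no_coexistence fy dy0 q0 yq y_gt0 y_decr gamma_gap cs) => x dx fx xNq.
have fxq := hill_flow_shift (hill_potential_period gamma fy dy0 yq) fx.
have [+ _] := normalized_repr cs (- q) fxq.
have [+ +] := normalized_repr cs tq fx.
have [+ _] := normalized_repr cs (- q) fx.
rewrite /= !add0r addrA addNr add0r xNq dcq sq -ad => e4 e5 e6 ->.
rewrite e5 e6; transitivity (c tq * (x 0 * c (- q) + dx 0 * s (- q))); first ring.
by rewrite -e4 mulr0.
Qed.

(** Translation by a period multiplies the form of [x] by mu^2 but also preserves it, so [x] is a
    null solution. *)
Lemma floquet_card_zeros mu x dx : mu ^+ 2 != 1 -> hill_flow Q x dx ->
  (exists t, x t != 0) -> (forall t, x (t + tq) = mu * x t) ->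
  ([set t | 0 <= t < tq /\ x t = 0] #= `I_1)%card.
Proof.
move=> mu2 fx [t1 xt1] xmu.
have dxmu t : dx (t + tq) = mu * dx t.
  have fxq := hill_flow_shift (hill_potential_period gamma fy dy0 yq) fx.
  have Dmu : has_deriv (fun t => x (t + tq)) (fun t => mu * dx t).
    rewrite (_ : (fun t => x (t + tq)) = fun t => mu * x t); last exact/funext.
    by have [Dx _] := fx; deriv; ring.
  exact: has_deriv_unique fxq.1 Dmu t.
have x_nontrivial t : x t = 0 -> dx t <> 0.
  move=> xt dxt; move: xt1.
  by rewrite (hill_flow_eq0 cs fx xt dxt) eqxx.
have x_null : lame_form y dy gamma x dx 0 = 0.
  have := lame_form_period fx; rewrite -[tq]add0r xmu dxmu => e.
  rewrite (lame_form_extremum _ fy dy0)//.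
  have /eqP : (mu ^+ 2 - 1) * (B * x 0 ^+ 2 + A * dx 0 ^+ 2) = 0.
    by lra.
  by rewrite mulf_eq0 subr_eq0 (negPf mu2) /= => /eqP F0; rewrite -[RHS]F0; ring.
have [p [p0q wp p_unique]] := lame_product_root fy q0 yq y_gt0 y_decr gamma_gap.
exact: (null_card_zeros fy dy0 yq gamma_gap p0q wp p_unique fx x_nontrivial x_null).
Qed.

End Monodromy.

Theorem theorem4 (R : realType)
    (y : R -> R -> R) (T : R -> R) (Phi : R -> R -> R -> 'M[R]_2)
    (Hy : forall delta : R, 0 < delta -> duffing_solution delta (y delta))
    (HT : forall delta : R, 0 < delta -> minimal_period (y delta) (T delta))
    (HPhi : forall delta gamma : R, 0 < delta -> 0 < gamma ->
      fundamental_matrix gamma (y delta) (Phi delta gamma)) :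
  tongue y T Phi 1 =
  [set p | let: (delta, gamma) := p in
    [/\ 0 < delta, 0 < gamma & 1 < gamma < 1 + delta ^+ 2 / 2]].
Proof.
apply/seteqP; split=> -[delta gamma] /=.
  case=> d0 g0 tr2 _; split=> //.
  have fy := duffing_flow_of_solution (Hy delta d0); have [_ _ y0 dy0] := Hy delta d0.
  have y0_gt0 : 0 < y delta 0 by rewrite y0.
  have [q [q0 tq yq ypos ydecr]] := duffing_quarter_period fy y0_gt0 dy0 (HT delta d0).
  have cs := normalized_pair_fundamental (HPhi delta gamma d0 g0).
  apply: contrapT => gap; move: tr2; rewrite mxtrace2 /monodromy /tau tq ltNge => /negP; apply.
  by apply: (stable_trace fy dy0 y0_gt0 yq cs g0); rewrite y0.
case=> d0 g0 gap.
have fy := duffing_flow_of_solution (Hy delta d0); have [_ _ y0 dy0] := Hy delta d0.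
have y0_gt0 : 0 < y delta 0 by rewrite y0.
have [q [q0 tq yq ypos ydecr]] := duffing_quarter_period fy y0_gt0 dy0 (HT delta d0).
have cs := normalized_pair_fundamental (HPhi delta gamma d0 g0).
rewrite -y0 in gap.
have tr2 := unstable_trace fy dy0 yq cs q0 ypos ydecr gap.
have det := normalized_wronskian cs (q + q).
rewrite /monodromy /tau tq; split=> //; first by rewrite mxtrace2.
move=> mu xi /eigenvalue_mx2 char_mu /hill_flow_of_solution fxi xi_n0 xi_mu.
apply: (floquet_card_zeros fy dy0 yq cs q0 ypos ydecr gap _ fxi xi_n0 xi_mu).
(* With determinant 1, mu^2 = 1 turns the characteristic equation into tr M * mu = 2, hence |tr M| =
   2, contrary to [tr2]. *)
apply/eqP => mu2; move: char_mu; rewrite det mu2 => char_mu.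
have tr_mu : (Phi delta gamma (q + q) 0 0 + Phi delta gamma (q + q) 1 1) * mu = 2 by lra.
have norm_mu : `|mu| = 1.
  by apply/eqP; rewrite -(@eqrXn2 _ 2)// real_normK ?num_real// mu2 expr1n.
move: tr2; have := congr1 (fun u : R => `|u|) tr_mu.
by rewrite normrM norm_mu mulr1 [RHS]ger0_norm// => ->; rewrite ltxx.
Qed.
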